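(* Let $G$ be a finite noncyclic nilpotent group of order $n=p_1^{\alpha_1}\cdots p_r^{\alpha_r}$, where $p_1<\cdots<p_r$ are primes, $\alpha_i\geq1$, and $r\geq 2$. For $i\in[r]$ let $P_i$ be the unique Sylow $p_i$-subgroup of $G$, and let $J=\{i\in[r]: P_i\text{ is noncyclic}\}$. Suppose that the center $Z(P_j)$ is noncyclic for every $j\in J$. Then: (i) If $J\neq[r]$ and $2\phi\left(\prod_{i\in[r]}p_i\right)\geq\prod_{i\in[r]}p_i$, then there exists $k\in[r]\setminus J$ such that $\delta(\mathcal{P}(G))=\deg\left(y^{p_k^{\alpha_k}}\right)$, where $\langle y\rangle\in\mathcal{M}(G)$ is of minimum order. (ii) If $J=[r]$ and $2\phi\left(\prod_{i\in[r]\setminus\{l\}}p_i\right)\geq\prod_{i\in[r]\setminus\{l\}}p_i$ for every $l\in[r]$, then $\delta(\mathcal{P}(G))=\deg(y)$, where $\langle y\rangle\in\mathcal{M}(G)$ is of minimum order.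
   Context: For a finite group $G$, the power graph $\mathcal{P}(G)$ is the simple graph with vertex set $G$ in which two distinct vertices are adjacent iff one is a positive power of the other. $\deg(v)$ denotes the degree of a vertex $v$ in $\mathcal{P}(G)$ and $\delta(\mathcal{P}(G))=\min_{v\in G}\deg(v)$. A cyclic subgroup of $G$ is maximal cyclic if it is not properly contained in any cyclic subgroup of $G$; $\mathcal{M}(G)$ denotes the set of maximal cyclic subgroups of $G$. $\phi$ is Euler's totient function and $[m]=\{1,\ldots,m\}$. *)

(* Defs.v *)
From mathcomp Require Import all_boot all_order all_fingroup all_solvable.

Set Implicit Arguments.
Unset Strict Implicit.
Unset Printing Implicit Defensive.

Local Open Scope group_scope.

Section PowerGraph.

Variable gT : finGroupType.
Implicit Types (x y : gT) (G C : {group gT}).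

(* [x] is a positive power of [y]; the exponents [1 .. #[y]] suffice, see
   [pos_powerP]. *)
Definition pos_power x y : bool := [exists m : 'I_#[y], x == y ^+ m.+1].

Lemma pos_powerP x y :
  reflect (exists m : nat, (0 < m)%N /\ x = y ^+ m) (pos_power x y).
Proof.
apply: (iffP existsP) => [[m /eqP->] | [[|m] [// _ ->]]]; first by exists m.+1.
exists (Ordinal (ltn_pmod m (order_gt0 y))).
by rewrite !expgS expg_mod_order.
Qed.

Definition power_adj : rel gT :=
  [rel x y | (x != y) && (pos_power x y || pos_power y x)].

Lemma power_adj_sym : symmetric power_adj.
Proof. by move=> x y; rewrite /power_adj /= eq_sym orbC. Qed.

Lemma power_adj_irr : irreflexive power_adj.
Proof. by move=> x; rewrite /power_adj /= eqxx. Qed.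

Definition power_deg G x : nat := #|[set z in G | power_adj x z]|.

Definition power_min_deg G : nat :=
  power_deg G [arg min_(v < 1 in G) power_deg G v].

Lemma power_min_degP G :
  (exists2 v, v \in G & power_min_deg G = power_deg G v) /\
  (forall v, v \in G -> power_min_deg G <= power_deg G v)%N.
Proof.
rewrite /power_min_deg; case: arg_minnP => [|v Gv minv]; first exact: group1.
by split; [exists v|].
Qed.

Definition max_cyclic G : {set {group gT}} :=
  [set C : {group gT} | [max C of H | (H \subset G) && cyclic H]].

Lemma max_cyclicP G C :
  reflect [/\ C \subset G, cyclic C
            & forall D : {group gT}, D \subset G -> cyclic D -> ~~ (C \proper D)]
          (C \in max_cyclic G).
Proof.
rewrite inE; apply: (iffP maxgroupP) => [[/andP[sCG cC] maxC] | [sCG cC maxC]].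
  split=> // D sDG cD; apply/negP=> /andP[sCD]; case/negP.
  by rewrite (maxC D) // sDG.
rewrite sCG cC; split=> // D /andP[sDG cD] sCD.
apply/eqP; rewrite eqEsubset sCD andbT.
by have:= maxC D sDG cD; rewrite properE sCD negbK.
Qed.

Definition min_order_max_cyclic G y : Prop :=
  <[y]>%G \in max_cyclic G /\
  (forall C : {group gT}, C \in max_cyclic G -> #[y] <= #|C|)%N.

End PowerGraph.

(* Main.v *)
(**
In a nilpotent group every element is the product of its [p_i]-constituents,
and the elements having [x] as a power, the elements of [<x>] and the
generators of [<x>] are all counted by products over the Sylow subgroups. Hence
[deg x + 1 = prod a_i + prod n_i - prod phi(a_i)], with [a_i] the order of the
constituent [x_i] and [n_i] the number of its roots in [P_i]. If [<x_i>] is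
maximal cyclic then [n_i = phi(a_i)]; if [P_i] is cyclic then
[n_i = phi(a_i) + #|P_i| - a_i]; and if [Z(P_i)] is noncyclic while [<x_i>] is
not maximal, a central element of order [p_i] outside a maximal cyclic subgroup
[<z>] above [x_i] gives [n_i >= phi(a_i) + p_i (#[z] - a_i)]. The hypotheses on
[phi] say that replacing orders by their totients costs at most a factor [2],
so one non-maximal constituent in a noncyclic [P_i] with [p_i] odd, or two in
cyclic ones, already make [prod n_i] large enough. What remains is a comparison of
elements with at most one non-maximal constituent.
*)
Require Import Defs.
From mathcomp Require Import all_boot all_order all_fingroup all_solvable.
From mathcomp Require Import zify.

Set Implicit Arguments.
Unset Strict Implicit.
Unset Printing Implicit Defensive.

(** * Roots of an element and their number in p-groups *)

Section Roots.

Local Open Scope group_scope.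

Variable gT : finGroupType.
Implicit Types (x y z : gT) (G H : {group gT}).

Definition power_roots (H : {set gT}) x : {set gT} := [set z in H | x \in <[z]>].

Definition max_cyclic_elt (H : {set gT}) x : bool :=
  (x \in H) && [forall z in H, (x \in <[z]>) ==> (z \in <[x]>)].

Lemma max_cyclic_eltP (H : {set gT}) x :
  reflect (x \in H /\ forall z, z \in H -> x \in <[z]> -> z \in <[x]>)
          (max_cyclic_elt H x).
Proof.
apply: (iffP andP) => -[Hx maxx]; split=> //.
  by move=> z Hz; apply/implyP; move/forall_inP: maxx; apply.
by apply/forall_inP => z Hz; apply/implyP; apply: maxx.
Qed.

Lemma max_cyclic_eltE G x : (<[x]>%G \in max_cyclic G) = max_cyclic_elt G x.
Proof.
apply/max_cyclicP/max_cyclic_eltP => [[sxG _ maxx] | [Gx maxx]].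
  rewrite -cycle_subG; split=> // z Gz xz.
  have /= := maxx <[z]>%G; rewrite cycle_subG cycle_cyclic => /(_ Gz isT).
  by rewrite properE !cycle_subG xz /= negbK.
split; rewrite /= ?cycle_subG ?cycle_cyclic // => D sDG /cyclicP[z defD].
move: sDG; rewrite properE defD !cycle_subG => Gz.
by rewrite negb_and negbK -implybE; apply/implyP; apply: maxx.
Qed.

Lemma pos_powerE x y : pos_power x y = (x \in <[y]>).
Proof.
apply/pos_powerP/cycleP => [[m [_ ->]] | [m ->]]; first by exists m.
exists (m + #[y])%N; split; first by rewrite ltn_addl.
by rewrite expgD expg_order mulg1.
Qed.

Lemma card_cycle_power_roots G x :
  x \in G -> #|<[x]> :&: power_roots G x| = totient #[x].
Proof.
move=> Gx; rewrite totient_gen; apply: eq_card => z.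
rewrite !inE /generator eqEsubset !cycle_subG andbC.
case: (boolP (x \in <[z]>)) => xz; rewrite ?andbF //= andbT.
apply: andb_idl => /(subsetP _); apply; by rewrite cycle_subG.
Qed.

(** The neighbours of [x] together with [x] form the union of [<[x]>] and the roots of [x]; these
    two sets meet in the generators of [<[x]>]. *)
Lemma power_degE G x :
  x \in G -> ((power_deg G x).+1 + totient #[x] = #[x] + #|power_roots G x|)%N.
Proof.
move=> Gx; rewrite -(card_cycle_power_roots Gx) -(cardsUI <[x]>); congr addn.
rewrite (cardsD1 x (_ :|: _)) inE cycle_id add1n; congr _.+1.
apply: eq_card => z; rewrite !inE /power_adj /= !pos_powerE eq_sym.
case: eqP => //= _; rewrite ?andbF // andb_orr orbC.
congr orb; apply: andb_idl => /(subsetP _); apply; by rewrite cycle_subG.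
Qed.

Lemma roots_max_cyclic_elt H x :
  max_cyclic_elt H x -> #|power_roots H x| = totient #[x].
Proof.
case/max_cyclic_eltP=> Hx maxx; rewrite -(card_cycle_power_roots Hx).
apply: eq_card => z; rewrite !inE.
by case: (boolP (z \in H)) => Hz; rewrite ?andbF //=; apply/esym/andb_idl; apply: maxx.
Qed.

(** A root of [x] of largest order works, because its own roots are again roots of [x]. *)
Lemma max_cyclic_elt_exists H x :
  x \in H -> exists2 z, max_cyclic_elt H z & x \in <[z]>.
Proof.
move=> Hx; have rx: x \in power_roots H x by rewrite inE Hx cycle_id.
case: (@arg_maxnP _ x (mem (power_roots H x)) (fun z => #[z]) rx) => z.
rewrite /= inE => /andP[Hz xz] maxz; exists z => //.
apply/max_cyclic_eltP; split=> // u Hu zu.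
have xu: x \in <[u]> by apply: subsetP xz; rewrite cycle_subG.
have ru : u \in power_roots H x by rewrite inE Hu.
have /eqP->: <[z]> == <[u]> by rewrite eqEcard cycle_subG zu; apply: maxz.
exact: cycle_id.
Qed.

(** Subgroups of a cyclic p-group form a chain, so [<[x]>] lies properly inside [<[y]>], hence
    inside its subgroup of index [p]. *)
Lemma cyclic_pgroup_chain (p : nat) H x y : prime p -> p.-group H -> cyclic H ->
  x \in H -> y \in H -> y \notin <[x]> -> x \in <[y ^+ p]>.
Proof.
move=> p_pr pH cycH Hx Hy.
have [[i oi] [j oj]] := (p_natP (mem_p_elt pH Hx), p_natP (mem_p_elt pH Hy)).
have memE u v : u \in H -> v \in H -> (u \in <[v]>) = (#[u] %| #[v])%N.
  by move=> Hu Hv; rewrite -cycle_subG -(cardSg_cyclic cycH) ?cycle_subG.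
rewrite !memE ?groupX // oi oj dvdn_Pexp2l ?prime_gt1 // -ltnNge => lt_ij.
rewrite orderXdiv oj; last by rewrite -{1}[p]expn1 dvdn_Pexp2l ?prime_gt1 //; lia.
rewrite -(@subnK 1 j); last by lia.
rewrite expnD expn1 mulnK ?prime_gt0 // dvdn_Pexp2l ?prime_gt1 //; lia.
Qed.

(** By the chain property every element outside [<[x]>] is a root of [x]; the roots inside are the
    generators. *)
Lemma card_roots_cyclic (p : nat) H x : prime p -> p.-group H -> cyclic H ->
  x \in H -> (#|power_roots H x| + #[x] = totient #[x] + #|H|)%N.
Proof.
move=> p_pr pH cycH Hx; rewrite -(card_cycle_power_roots Hx).
rewrite -(cardsID <[x]> (power_roots H x)) setIC -addnA; congr addn.
have sxH: <[x]> \subset H by rewrite cycle_subG.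
rewrite -(cardsID <[x]> H) (setIidPr sxH) addnC; congr addn.
apply: eq_card => z; rewrite !inE; case: (boolP (z \in <[x]>)) => //= xz.
apply: andb_idr => Hz; have: x \in <[z ^+ p]> by apply: cyclic_pgroup_chain Hz xz.
by apply: subsetP; rewrite cycleX.
Qed.

(** If [<[z]>] contained ['Ohm_1('Z(H))], then ['Z(H)] would have rank at most one and be cyclic. *)
Lemma noncyclic_central_elt (p : nat) H z : p.-group H -> ~~ cyclic 'Z(H) ->
  exists w, [/\ w \in 'Z(H), #[w] = p & w \notin <[z]>].
Proof.
move=> pH ncZ; have pZ : p.-group 'Z(H) := pgroupS (center_sub H) pH.
have aZ := center_abelian H.
have /subsetPn[w Ow zw]: ~~ ('Ohm_1('Z(H)) \subset <[z]>).
  apply: contra ncZ => sOz; rewrite abelian_rank1_cyclic // -rank_Ohm1.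
  by rewrite -abelian_rank1_cyclic ?(cyclicS sOz) ?cycle_cyclic ?(abelianS (Ohm_sub _ _)).
exists w; split=> //; first exact: subsetP (Ohm_sub _ _) w Ow.
apply: (abelem_order_p (Ohm1_abelem pZ aZ)) => //.
by apply: contraNneq zw => ->; apply: group1.
Qed.

(* With [w] central of order [p] outside the maximal cyclic [<z>] above [x],
   every element of [<z><w>] outside [<x><w>] is a root of [x], because its
   [p]-th power already generates a group containing [x]. *)
Lemma card_roots_noncyclic_center (p : nat) H x :
    prime p -> p.-group H -> ~~ cyclic 'Z(H) -> x \in H ->
    ~~ max_cyclic_elt H x ->
  exists2 z, max_cyclic_elt H z &
    (p * #[x] <= #[z])%N /\
    (totient #[x] + p * #[z] <= #|power_roots H x| + p * #[x])%N.
Proof.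
move=> p_pr pH ncZ Hx nmx; have [z maxz xz] := max_cyclic_elt_exists Hx.
have /max_cyclic_eltP[Hz mz] := maxz; exists z => //.
have [w [/centerP[Hw cw] ow zw]] := noncyclic_central_elt z pH ncZ.
(* Otherwise every root of [x] would be a root of [z], and [x] would be maximal. *)
have zx: z \notin <[x]>.
  apply: contra nmx => zx; apply/max_cyclic_eltP; split=> // u Hu xu.
  have zu: z \in <[u]> by apply: subsetP zx; rewrite cycle_subG.
  by have := mz u Hu zu; apply: subsetP; rewrite cycle_subG.
have pz : p.-group <[z]> by apply: pgroupS pH; rewrite cycle_subG.
have sxz : <[x]> \subset <[z]> by rewrite cycle_subG.
split.
  have xzp := cyclic_pgroup_chain p_pr pz (cycle_cyclic z) xz (cycle_id z) zx.
  have p_dv_z : (p %| #[z])%N.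
    have [[|j] oj] := p_natP pz; last by rewrite /order oj expnS dvdn_mulr.
    move: zx; rewrite (_ : z = 1) ?group1 //; apply/eqP; rewrite -order_eq1.
    by rewrite /order oj.
  rewrite mulnC -leq_divRL ?prime_gt0 // -(orderXdiv p_dv_z).
  by apply: subset_leq_card; rewrite cycle_subG.
have tizw : <[z]> :&: <[w]> = 1.
  rewrite setIC; apply/prime_TIg; first by rewrite -orderE ow.
  by rewrite cycle_subG.
have czw u v : u \in <[z]> -> v \in <[w]> -> commute u v.
  move=> zu /cycleP[j ->]; apply: commuteX; apply/commute_sym; apply: cw.
  by apply: subsetP zu; rewrite cycle_subG.
pose A := setX (<[z]> :\: <[x]>) <[w]>; pose f (uv : gT * gT) := uv.1 * uv.2.
have injf : {in A &, injective f}.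
  move=> [u v] [u' v']; rewrite !inE /= /f /= => /andP[/andP[_ zu] wv].
  case/andP=> [/andP[_ zu'] wv'] eq_uv.
  have eq1 : u'^-1 * u = v' * v^-1 by rewrite -(mulgK v u) eq_uv !mulgA mulVg mul1g.
  have: u'^-1 * u \in <[z]> :&: <[w]>.
    by rewrite inE {2}eq1 !groupM ?groupV.
  rewrite tizw inE -eq_mulVg1 => /eqP eu; move: eq_uv; rewrite eu => /mulgI->.
  by [].
have cardA : (#|f @: A| + p * #[x] = p * #[z])%N.
  rewrite card_in_imset // cardsX -orderE ow mulnC -mulnDr; congr muln.
  by rewrite -[RHS](cardsID <[x]>) addnC (setIidPr sxz).
(* If [u * v] lies in [<[x]>], then [v] lies in both [<[z]>] and [<[w]>], so [v = 1] and [u] is in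
   [<[x]>], which [A] excludes. *)
have dis : <[x]> :&: power_roots H x :&: (f @: A) = set0.
  apply/setP=> t; rewrite inE in_set0; apply/negP => /andP[/setIP[xt _]].
  case/imsetP=> -[u v] /setXP[] /=; rewrite !inE /f /= => /andP[xu zu] wv tE.
  case/negP: xu; have zt := subsetP sxz t xt.
  have zv : v \in <[z]> by rewrite -(groupMl v zu) -tE.
  have /set1P v1: v \in [1 gT] by rewrite -[[1 gT]]tizw inE zv.
  by rewrite -(mulg1 u) -v1 -tE.
have sub : <[x]> :&: power_roots H x :|: f @: A \subset power_roots H x.
  rewrite subUset subsetIr; apply/subsetP => t /imsetP[[u v] /setXP[] /=].
  rewrite !inE /f /= => /andP[xu zu] wv ->{t}.
  have Hu : u \in H by apply: subsetP zu; rewrite cycle_subG.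
  have Hv : v \in H by apply: subsetP wv; rewrite cycle_subG.
  rewrite groupM //=.
  have : x \in <[u ^+ p]>.
    by apply: cyclic_pgroup_chain (cycle_cyclic z) _ _ _.
  have <- : (u * v) ^+ p = u ^+ p.
    rewrite expgMn; last exact: czw.
    rewrite [v ^+ p](_ : _ = 1) ?mulg1 //; apply/eqP; rewrite -order_dvdn -ow.
    exact: order_dvdG.
  by apply: subsetP; rewrite cycleX.
have := subset_leq_card sub; rewrite cardsU dis cards0 subn0 card_cycle_power_roots //.
by rewrite -cardA addnA leq_add2r.
Qed.

End Roots.

(** * Reduction of counts and of maximality to the Sylow subgroups *)

Section PrimaryComponents.

Local Open Scope group_scope.

Variables (gT : finGroupType) (G : {group gT}) (r : nat) (p : 'I_r -> nat).
Variable P : 'I_r -> {group gT}.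
Hypothesis nilG : nilpotent G.
Hypothesis piG : forall q, q \in \pi(G) -> exists i, q = p i.
Hypothesis sylP : forall i, (p i).-Sylow(G) (P i).
Hypothesis cardG : #|G| = (\prod_(i < r) #|P i|)%N.
Implicit Types x y z : gT.

Lemma constt_mem_sylow x i : x \in G -> x.`_(p i) \in P i.
Proof.
move=> Gx; have nPG : P i <| G by rewrite (nilpotent_Hall_pcore nilG (sylP i)) pcore_normal.
by rewrite (mem_normal_Hall (sylP i) nPG) ?p_elt_constt ?groupX.
Qed.

Lemma mem_constt_sub (H : {group gT}) x :
  x \in G -> (forall i, x.`_(p i) \in H) -> x \in H.
Proof.
move=> Gx Hx; rewrite -(prod_constt x); apply: group_prod => q _.
have [/piG[i ->] | nq] := boolP (q \in \pi(G)); first exact: Hx.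
have /constt1P-> : q^'.-elt x; last exact: group1.
apply: mem_p_elt Gx; apply/pgroupP=> s s_pr s_dv; rewrite !inE.
by apply: contraNneq nq => <-; rewrite mem_primes s_pr cardG_gt0.
Qed.

Lemma cycle_constt_sub x z :
  x \in G -> z \in G -> (x \in <[z]>) = [forall i, x.`_(p i) \in <[z.`_(p i)]>].
Proof.
move=> Gx Gz; apply/idP/forallP => [/cycleP[m ->] i | xz].
  by rewrite consttX mem_cycle.
apply: mem_constt_sub => // i.
have := xz i; apply: subsetP; rewrite cycle_subG; exact: cycle_constt.
Qed.

Definition constts z : {ffun 'I_r -> gT} := [ffun i => z.`_(p i)].

(** Equal constituents put [x] in [<[y]>], so the two commute; constituents are then multiplicative,
    and those of [y^-1 * x] are trivial. *)
Lemma constts_inj : {in G &, injective constts}.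
Proof.
move=> x y Gx Gy /ffunP eqxy.
have eqi i : x.`_(p i) = y.`_(p i) by have:= eqxy i; rewrite !ffunE.
have /cycleP[m defx] : x \in <[y]>.
  by rewrite cycle_constt_sub //; apply/forallP=> i; rewrite eqi cycle_id.
have cyx : commute y^-1 x by rewrite defx; apply/commuteX/commute_sym/commuteV.
have /set1gP : y^-1 * x \in [1 gT].
  apply: mem_constt_sub => [|i]; first by rewrite groupM ?groupV.
  by rewrite consttM // consttV eqi mulVg group1.
by move=> yx1; rewrite -(mulKVg y x) yx1 mulg1.
Qed.

(** Injectivity and [cardG] make both sides equally large, so one inclusion suffices. *)
Lemma constts_im : constts @: G =i family (fun i => mem (P i)).
Proof.
apply/subset_cardP; last first.
  apply/subsetP=> _ /imsetP[z Gz ->]; apply/familyP=> i.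
  by rewrite ffunE; apply: constt_mem_sylow.
rewrite (card_in_imset constts_inj) card_family cardG foldrE big_map.
by rewrite big_enum.
Qed.

Lemma constts_surj (f : 'I_r -> gT) : (forall i, f i \in P i) ->
  exists2 z, z \in G & forall i, z.`_(p i) = f i.
Proof.
move=> Pf; have: finfun f \in constts @: G.
  by rewrite constts_im; apply/familyP=> i; rewrite ffunE.
by case/imsetP=> z Gz /ffunP fz; exists z => // i; have:= fz i; rewrite !ffunE.
Qed.

(** A set cut out by independent conditions on the constituents is a product. This serves for
    [<[x]>], its generators, and the roots of [x]. *)
Lemma card_constts (A : {set gT}) (B : 'I_r -> {set gT}) :
    A \subset G -> (forall i, B i \subset P i) ->
    (forall z, z \in G -> (z \in A) = [forall i, z.`_(p i) \in B i]) ->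
  #|A| = (\prod_i #|B i|)%N.
Proof.
move=> sAG sBP AE.
have injA: {in A &, injective constts} by apply: sub_in2 constts_inj; apply/subsetP.
rewrite -(card_in_imset injA).
transitivity #|family (fun i => mem (B i))|; last first.
  by rewrite card_family foldrE big_map big_enum.
apply: eq_card => f; apply/imsetP/familyP => [[z Az ->] j | Bf].
  by rewrite ffunE; move: (Az); rewrite AE ?(subsetP sAG) // => /forallP.
have Pf i : f i \in P i by apply: subsetP (sBP i) _ (Bf i).
have [z Gz zf] := constts_surj Pf; exists z.
  by rewrite AE //; apply/forallP=> i; rewrite zf Bf.
by apply/ffunP=> i; rewrite ffunE zf.
Qed.

Lemma order_constts x : x \in G -> #[x] = (\prod_i #[x.`_(p i)])%N.
Proof.
move=> Gx; apply: card_constts => [|i|z Gz]; rewrite ?cycle_subG ?constt_mem_sylow //.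
exact: cycle_constt_sub.
Qed.

Lemma card_roots_constts x :
  x \in G -> #|power_roots G x| = (\prod_i #|power_roots (P i) x.`_(p i)|)%N.
Proof.
move=> Gx; apply: card_constts => [|i|z Gz];
  try by apply/subsetP => z; rewrite inE => /andP[].
rewrite inE Gz cycle_constt_sub //=; apply: eq_forallb => i.
by rewrite inE constt_mem_sylow.
Qed.

Lemma totient_order_constts x :
  x \in G -> totient #[x] = (\prod_i totient #[x.`_(p i)])%N.
Proof.
move=> Gx; rewrite -(card_cycle_power_roots Gx).
under eq_bigr => i _ do rewrite -(card_cycle_power_roots (constt_mem_sylow i Gx)).
apply: card_constts => [|i|z Gz].
- by rewrite subIset // cycle_subG Gx.
- by rewrite subIset // cycle_subG constt_mem_sylow.
rewrite !inE Gz !cycle_constt_sub //=.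
apply/andP/forallP => [[/forallP xz /forallP zx] i | xz].
  by rewrite !inE xz zx constt_mem_sylow.
by split; apply/forallP => i; have := xz i; rewrite !inE => /and3P[].
Qed.

Lemma power_deg_constts x : x \in G ->
  ((power_deg G x).+1 + \prod_i totient #[x.`_(p i)] =
   \prod_i #[x.`_(p i)] + \prod_i #|power_roots (P i) x.`_(p i)|)%N.
Proof.
move=> Gx; rewrite -totient_order_constts // -order_constts //.
by rewrite -card_roots_constts // power_degE.
Qed.

Lemma max_cyclic_elt_constts x : x \in G ->
  max_cyclic_elt G x = [forall i, max_cyclic_elt (P i) x.`_(p i)].
Proof.
move=> Gx; apply/max_cyclic_eltP/forallP => [[_ maxx] i | maxx].
  apply/max_cyclic_eltP; split=> [|z Pz xz]; first exact: constt_mem_sylow.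
  (* Replacing only the [i]-th constituent of [x] by [z] gives a root [u] of [x]. *)
  pose f j := if j == i then z else x.`_(p j).
  have [|u Gu uf] := @constts_surj f.
    by move=> j; rewrite /f; case: eqP => [->|_] //; apply: constt_mem_sylow.
  have: u \in <[x]>.
    apply: maxx => //; rewrite cycle_constt_sub //; apply/forallP => j.
    by rewrite uf /f; case: eqP => [->|_] //; apply: cycle_id.
  by rewrite (cycle_constt_sub Gu Gx) => /forallP ux; move: (ux i); rewrite uf /f eqxx.
split=> // z Gz; rewrite !cycle_constt_sub // => /forallP xz.
apply/forallP=> i; have /max_cyclic_eltP[_] := maxx i; apply=> //.
exact: constt_mem_sylow.
Qed.

(** Exchanging one constituent of [y] for a generator [v] of another maximal cyclic subgroup keeps
    the element maximal, so minimality of [#[y]] passes to each factor. *)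
Lemma min_order_max_cyclic_constts y : min_order_max_cyclic G y ->
  [/\ y \in G, forall i, max_cyclic_elt (P i) y.`_(p i)
    & forall i v, max_cyclic_elt (P i) v -> (#[y.`_(p i)] <= #[v])%N].
Proof.
case; rewrite max_cyclic_eltE => maxy miny.
have /max_cyclic_eltP[Gy _] := maxy.
move: maxy; rewrite max_cyclic_elt_constts // => /forallP maxy; split=> // i v maxv.
pose f j := if j == i then v else y.`_(p j).
have [|u Gu uf] := @constts_surj f.
  move=> j; rewrite /f; case: eqP => [->|_]; last exact: constt_mem_sylow.
  by case/max_cyclic_eltP: maxv.
have: (#[y] <= #|<[u]>%G|)%N.
  apply: miny; rewrite max_cyclic_eltE max_cyclic_elt_constts //.
  by apply/forallP=> j; rewrite uf /f; case: eqP => [->|_].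
rewrite /= -orderE (order_constts Gy) (order_constts Gu).
rewrite (bigD1 i) //= [X in (_ <= X)%N](bigD1 i) //=.
have -> : (\prod_(j < r | j != i) #[u.`_(p j)] = \prod_(j < r | j != i) #[y.`_(p j)])%N.
  by apply: eq_bigr => j ne_ji; rewrite uf /f (negPf ne_ji).
by rewrite uf /f eqxx leq_pmul2r // prodn_gt0 // => j; apply: order_gt0.
Qed.

End PrimaryComponents.

(** * Totients of prime powers and an inequality between primes *)

Lemma totient_leq m : totient m <= m.
Proof.
rewrite totient_count_coprime big_mkord -[X in _ <= X]card_ord -sum1_card.
by apply: leq_sum => i _; apply: leq_b1.
Qed.

Lemma totient_prime_power_mul q t :
  prime q -> 0 < t -> totient (q ^ t) * q = q ^ t * q.-1.
Proof.
by move=> q_pr t_gt0; rewrite totient_pfactor // -mulnA -expnSr prednK // mulnC.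
Qed.

Lemma totient_prime_power_leq q s t :
  prime q -> s <= t -> totient (q ^ s) <= totient (q ^ t).
Proof.
move=> q_pr; case: t => [|t]; first by rewrite leqn0 => /eqP->.
case: s => [_|s lest]; first by rewrite totient_gt0 expn_gt0 prime_gt0.
by rewrite !totient_pfactor // leq_mul2l leq_pexp2l ?prime_gt0 ?orbT.
Qed.

Lemma totient_prod_primes (I : finType) (p : I -> nat) (Q : pred I) :
    (forall i, prime (p i)) -> injective p ->
  totient (\prod_(i | Q i) p i) = \prod_(i | Q i) (p i).-1.
Proof.
move=> p_pr p_inj; rewrite -big_filter -[RHS]big_filter.
elim: filter (filter_uniq Q (index_enum_uniq I)) => [|i s IH] /=.
  by rewrite !big_nil.
case/andP=> nsi us; rewrite !big_cons totient_coprime ?IH ?totient_prime //.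
rewrite big_seq; apply: (big_ind (coprime (p i))) => [|m1 m2|j js].
- exact: coprimen1.
- by rewrite coprimeMr => -> ->.
rewrite prime_coprime // dvdn_prime2 //; apply: contraNneq nsi.
by move/p_inj->.
Qed.

(** For [q > 0] this is [1 + 1/m <= (1 + 1/q) * (1 - 1/q'^2)], cleared of denominators. The extreme
    case [q' = q + 1], [m = q'] gives equality. *)
Lemma prime_gap_bound q q' m : q < q' -> q' <= m ->
  q * q' ^ 2 * m.+1 <= q.+1 * (q' ^ 2).-1 * m.
Proof.
case: q' => // s; rewrite ltnS => leqs ltsm.
have h1 : s * s.+1 * s.+1 <= s * s.+1 * m by rewrite leq_mul2l ltsm orbT.
have h2 : q * (s.+1 * s.+1) <= s * (s.+1 * s.+1) by rewrite leq_mul2r leqs orbT.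
have h3 : q.+1 * m <= s.+1 * m by rewrite leq_mul2r ltnS leqs orbT.
rewrite -mulnn (_ : (s.+1 * s.+1).-1 = s * s + 2 * s); last by lia.
nia.
Qed.

(** * Inequalities between products over the primes *)

Section PrimaryArithmetic.

(** For an element [x], [a i] and [n i] stand for the order and the number of roots of its
    constituent in [P i], [e i] for the least order of a maximal cyclic subgroup of [P i], and [D]
    for [deg x + 1]. [cyc i] means that [P i] is cyclic, [mx i] that the constituent is maximal. *)
Variables (I : finType) (p e a n : I -> nat) (cyc mx : pred I) (D : nat).

Hypothesis p_pr : forall i, prime (p i).
Hypothesis p_inj : injective p.
Hypothesis e_pow : forall i, exists2 t, 0 < t & e i = p i ^ t.
Hypothesis a_pow : forall i, exists s, a i = p i ^ s.
Hypothesis mxP : forall i, mx i -> n i = totient (a i) /\ e i <= a i.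
Hypothesis cycP : forall i, cyc i -> n i + a i = totient (a i) + e i.
Hypothesis cyc_nmxP : forall i, cyc i -> ~~ mx i -> p i * a i <= e i.
Hypothesis ncyc_nmxP : forall i, ~~ cyc i -> ~~ mx i ->
  exists e', [/\ e i <= e', p i * a i <= e'
               & totient (a i) + p i * e' <= n i + p i * a i].
Hypothesis DE :
  D + \prod_i totient (a i) = \prod_i a i + \prod_i n i.

Let p_gt1 i : 1 < p i. Proof. exact: prime_gt1. Qed.

Let e_gt0 i : 0 < e i.
Proof. by case: (e_pow i) => t _ ->; rewrite expn_gt0 prime_gt0. Qed.

Let a_gt0 i : 0 < a i.
Proof. by case: (a_pow i) => s ->; rewrite expn_gt0 prime_gt0. Qed.

Let p_leq_e i : p i <= e i.
Proof. by case: (e_pow i) => -[|t] // _ ->; rewrite expnS leq_pmulr // expn_gt0 prime_gt0. Qed.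

Let totient_e i : totient (e i) * p i = e i * (p i).-1.
Proof. by case: (e_pow i) => t t_gt0 ->; apply: totient_prime_power_mul. Qed.

Lemma totient_e_leq_a i : e i <= a i -> totient (e i) <= totient (a i).
Proof.
case: (e_pow i) (a_pow i) => t _ -> [s ->]; rewrite leq_exp2l ?p_gt1 //.
exact: totient_prime_power_leq.
Qed.

Lemma totient_a_leq_n i : totient (a i) <= n i.
Proof.
have [/mxP[-> _] // | nm] := boolP (mx i).
have [c | nc] := boolP (cyc i).
  have := cycP c; have := cyc_nmxP c nm.
  have := leq_pmull (a i) (ltnW (p_gt1 i)); lia.
have [e' [_ le1 le2]] := ncyc_nmxP nc nm.
have : p i * a i <= p i * e'.
  by apply: leq_trans le1 _; rewrite leq_pmull // ltnW ?p_gt1.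
lia.
Qed.

(** Since [p i * a i <= e'], the number [p i * (e' - a i)] is at least [(p i - 1) * e']. *)
Lemma ncyc_root_bound i : ~~ cyc i -> ~~ mx i -> (p i).-1 * e i <= n i.
Proof.
move=> nc nm; have [e' [le0 le1 le2]] := ncyc_nmxP nc nm.
have := leq_mul (leqnn (p i).-1) le0.
case: (p i) (p_gt1 i) le1 le2 => // q _ /=; rewrite !mulSn; lia.
Qed.

(** In the cyclic non-maximal case, [n i >= e i - a i >= e i - e i / p i = totient (e i)]. *)
Lemma totient_e_leq_n i : totient (e i) <= n i.
Proof.
have [mi | nm] := boolP (mx i).
  by have [-> /totient_e_leq_a] := mxP mi.
have [c | nc] := boolP (cyc i).
  have := cycP c; have := cyc_nmxP c nm; have := totient_e i.
  case: (p i) (p_gt1 i) => // q _ /=; rewrite !mulnS mulSn => eq1 le1 eq2.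
  rewrite -(leq_pmul2r (ltn0Sn q)) !mulnS eq1.
  have: (n i + a i) * q >= e i * q by rewrite leq_mul2r; apply/orP; right; lia.
  rewrite mulnDl; lia.
apply: leq_trans (ncyc_root_bound nc nm).
apply: leq_trans (totient_leq _) _.
by rewrite leq_pmull // -ltnS prednK ?p_gt1 // ltnW ?p_gt1.
Qed.

Lemma prod_a_leq_D : \prod_i a i <= D.
Proof.
rewrite -(leq_add2r (\prod_i totient (a i))) DE leq_add2l.
by apply: leq_prod => i _; apply: totient_a_leq_n.
Qed.

Lemma prod_n_leq_D : \prod_i n i <= D.
Proof.
rewrite -(leq_add2r (\prod_i totient (a i))) DE addnC leq_add2r.
by apply: leq_prod => i _; apply: totient_leq _.
Qed.

(* A prime power [q] of [p] has [totient q / q = totient p / p], so the bound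
   on the radical carries over to every product of prime powers. *)
Lemma totient_ratio (Q : pred I) (b : I -> nat) :
    (forall i, Q i -> totient (b i) * p i = b i * (p i).-1) ->
    \prod_(i | Q i) p i <= 2 * \prod_(i | Q i) (p i).-1 ->
  \prod_(i | Q i) b i <= 2 * \prod_(i | Q i) totient (b i).
Proof.
move=> bE lep.
have p_gt0 : 0 < \prod_(i | Q i) p i by rewrite prodn_gt0 // => i; apply: prime_gt0.
have bpE : (\prod_(i | Q i) totient (b i)) * \prod_(i | Q i) p i =
           (\prod_(i | Q i) b i) * \prod_(i | Q i) (p i).-1.
  by rewrite -big_split -[RHS]big_split; apply: eq_bigr.
by rewrite -(leq_pmul2r p_gt0) -mulnA bpE mulnCA leq_mul2l lep orbT.
Qed.

(** The factor 2 gained at [l] pays for replacing every other [e i] by its totient, which is at most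
    [n i]. *)
Lemma prod_e_leq_prod_n l : 2 * e l <= n l ->
    \prod_(i | i != l) p i <= 2 * \prod_(i | i != l) (p i).-1 ->
  \prod_i e i <= \prod_i n i.
Proof.
move=> le2 lep; rewrite (bigD1 l) //= [X in _ <= X](bigD1 l) //=.
have le3 := totient_ratio (fun i _ => totient_e i) lep.
apply: leq_trans (leq_mul (leqnn (e l)) le3) _; rewrite mulnCA mulnA.
by apply: leq_mul => //; apply: leq_prod => i _; apply: totient_e_leq_n.
Qed.

(** Maximal constituents have [n i = totient (a i)], so two of the products share all factors but
    the one at [l]. The truncated subtraction is exact by [totient_a_leq_n]. *)
Lemma D_one_nonmax l : (forall i, i != l -> mx i) ->
  D = a l * \prod_(i | i != l) a i
      + (n l - totient (a l)) * \prod_(i | i != l) totient (a i).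
Proof.
move=> mx_l.
have nE : \prod_(i | i != l) n i = \prod_(i | i != l) totient (a i).
  by apply: eq_bigr => i /mx_l/mxP[].
move: DE; rewrite [\prod_i totient _](bigD1 l) //= [\prod_i a i](bigD1 l) //=.
rewrite [\prod_i n i](bigD1 l) //= nE.
have := leq_mul (totient_a_leq_n l) (leqnn (\prod_(i | i != l) totient (a i))).
rewrite mulnBl; lia.
Qed.

Lemma prod_e_leq_prod_a (Q : pred I) :
  (forall i, Q i -> mx i) -> \prod_(i | Q i) e i <= \prod_(i | Q i) a i.
Proof. by move=> mxQ; apply: leq_prod => i /mxQ/mxP[]. Qed.

Lemma noncyclic_degree_bound : (forall i, ~~ cyc i) ->
    (forall l, \prod_(i | i != l) p i <= 2 * \prod_(i | i != l) (p i).-1) ->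
  \prod_i e i <= D.
Proof.
move=> nc lep.
(* A non-maximal constituent at an odd prime supplies the factor [p l - 1 >= 2]. *)
have [/existsP[l /andP[nml p_gt2]] | no_odd] := boolP [exists l, ~~ mx l && (2 < p l)].
  apply: leq_trans (prod_e_leq_prod_n _ (lep l)) prod_n_leq_D.
  apply: leq_trans (ncyc_root_bound (nc l) nml); apply: leq_mul => //; lia.
have p2 l : ~~ mx l -> p l = 2.
  move=> nml; apply/eqP; rewrite eqn_leq p_gt1 andbT leqNgt.
  by apply: contra no_odd => p_gt2; apply/existsP; exists l; rewrite nml.
have [/existsP[l nml] | all_mx] := boolP [exists l, ~~ mx l]; last first.
  apply: leq_trans prod_a_leq_D; apply: prod_e_leq_prod_a => i _.
  by apply: contraNT all_mx => nmi; apply/existsP; exists i.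
(* Non-maximal constituents now all belong to the prime 2, so [l] is the only one. *)
have mx_l i : i != l -> mx i.
  by apply: contraNT => nmi; apply/eqP/p_inj; rewrite !p2.
have [e' [le0 le1 le2]] := ncyc_nmxP (nc l) nml.
have le3 : \prod_(i | i != l) a i <= 2 * \prod_(i | i != l) totient (a i).
  apply: totient_ratio (lep l) => i /mx_l/mxP[_ le_ea].
  case: (a_pow i) => s aE; rewrite aE; apply: totient_prime_power_mul => //.
  have := leq_trans (p_gt1 i) (leq_trans (p_leq_e i) le_ea).
  by rewrite aE; case: (s).
rewrite (D_one_nonmax mx_l) (bigD1 l) //=.
apply: leq_trans (leq_mul le0 (prod_e_leq_prod_a mx_l)) _.
move: le1 le2 le3; rewrite (p2 l nml).
set A := \prod_(i | _) a i; set F := \prod_(i | _) totient _ => le1 le2 le3.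
(* The gain [2 * (e' - a l)] at [l], times the totients [F], covers [e' - a l] times the orders
   [A]. *)
have -> : e' = a l + (e' - a l) by lia.
rewrite mulnDl leq_add2l; apply: leq_trans (leq_mul (leqnn _) le3) _.
rewrite mulnCA mulnA; apply: leq_mul => //; lia.
Qed.

(* One more than the degree of [y ^+ #|P k|], see [power_deg_omit]. *)
Definition deg_omit k :=
  \prod_(i | i != k) e i + (e k).-1 * \prod_(i | i != k) totient (e i).

Lemma deg_omit_leq k : deg_omit k <= \prod_i e i.
Proof.
rewrite /deg_omit [X in _ <= X](bigD1 k) //= -{2}(prednK (e_gt0 k)).
rewrite mulSn leq_add2l leq_mul2l leq_prod ?orbT // => i _.
exact: totient_leq _.
Qed.

(** If [a i = p i ^ s.+1], then [n i = e i - p i ^ s] while [p i ^ s.+2 <= e i]; if [a i = 1], then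
    [n i = e i]. *)
Lemma cyc_nmx_bound i : cyc i -> ~~ mx i ->
  (p i ^ 2).-1 * e i <= p i ^ 2 * n i.
Proof.
move=> c nm; have := cycP c; have := cyc_nmxP c nm.
have [[|s] aE] := a_pow i; rewrite aE.
  rewrite expn0 (_ : totient 1 = 1) // => _ nE; have -> : n i = e i by lia.
  by rewrite leq_mul2r leq_pred orbT.
rewrite totient_pfactor //= => le1 nE.
have {nE} nE : n i + p i ^ s = e i.
  have pS : p i * p i ^ s = p i ^ s + (p i).-1 * p i ^ s.
    by rewrite -mulSn prednK ?prime_gt0.
  by move: nE; rewrite expnS pS; lia.
have {le1} : p i ^ 2 * p i ^ s <= e i by rewrite -expnD addnC addn2 expnSr mulnC.
have -> : p i ^ 2 = (p i ^ 2).-1.+1 by rewrite prednK ?expn_gt0 ?prime_gt0.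
by rewrite /= -nE mulSn mulnDr; lia.
Qed.

(** At the smaller prime the bound reads [n j >= (1 + 1/p j) * totient (e j)]. By [prime_gap_bound]
    with [m = e i], this gain outweighs both the factor [1 - 1/p i ^ 2] at the larger prime and the
    successor on [e i]. *)
Lemma two_cyclic_roots i j : cyc i -> cyc j -> ~~ mx i -> ~~ mx j ->
  p j < p i -> (e i).+1 * totient (e j) <= n i * n j.
Proof.
move=> ci cj nmi nmj ltp.
have bi := cyc_nmx_bound ci nmi; have bj := cyc_nmx_bound cj nmj.
have ej := totient_e j; have pe := p_leq_e i.
have pj := p_gt1 j.
have {bj ej} bj : (p j).+1 * totient (e j) <= p j * n j.
  rewrite -(leq_pmul2l (prime_gt0 (p_pr j))); nia.
have c : p j * p i ^ 2 * (e i).+1 <= (p j).+1 * (p i ^ 2).-1 * e i.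
  exact: prime_gap_bound.
have pp : 0 < p j * p i ^ 2 by rewrite muln_gt0 expn_gt0 !prime_gt0.
rewrite -(leq_pmul2l pp) mulnA.
apply: leq_trans (leq_mul c (leqnn _)) _.
by have := leq_mul bi bj; nia.
Qed.

Lemma cyclic_degree_bound : 1 < #|I| ->
    \prod_i p i <= 2 * \prod_i (p i).-1 ->
  (exists2 k, cyc k & deg_omit k <= D) \/ \prod_i e i <= D.
Proof.
move=> cardI lep.
have lep_l l : \prod_(i | i != l) p i <= 2 * \prod_(i | i != l) (p i).-1.
  move: lep; rewrite (bigD1 l) //= [X in _ <= _ * X](bigD1 l) //= => lep.
  rewrite -(leq_pmul2l (prime_gt0 (p_pr l))); apply: leq_trans lep _.
  by rewrite mulnCA leq_mul2r leq_pred !orbT.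
(* If [p l = 2], the hypothesis would bound the product of the other primes by that of their
   predecessors, impossible since another index exists. *)
have p_gt2 l : 2 < p l.
  rewrite ltn_neqAle p_gt1 andbT; apply/eqP => pl2.
  have [j nejl] : exists j, j != l.
    apply/existsP; apply: contraTT cardI; rewrite negb_exists => /forallP all_l.
    rewrite -leqNgt -(card1 l) subset_leq_card //; apply/subsetP => j _.
    by rewrite inE; have := all_l j; rewrite negbK.
  move: lep; rewrite (bigD1 l) //= [X in _ <= _ * X](bigD1 l) //= -pl2 mul1n.
  rewrite leq_pmul2l // (bigD1 j) //= [X in _ <= X](bigD1 j) //=.
  set A := \prod_(i | _) p i; set B := \prod_(i | _) _.
  have A_gt0 : 0 < A by rewrite prodn_gt0 // => i; apply: prime_gt0.
  have leBA : B <= A by apply: leq_prod => i _; apply: leq_pred.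
  have := p_gt1 j; nia.
have [/existsP[l /andP[ncl nml]] | J_mx] := boolP [exists l, ~~ cyc l && ~~ mx l].
  right; apply: leq_trans (prod_e_leq_prod_n _ (lep_l l)) prod_n_leq_D.
  apply: leq_trans (ncyc_root_bound ncl nml); apply: leq_mul => //.
  have := p_gt2 l; lia.
have nm_cyc i : ~~ mx i -> cyc i.
  by move=> nmi; apply: contraNT J_mx => nci; apply/existsP; exists i; rewrite nci.
have [/existsP[l nml] | all_mx] := boolP [exists l, ~~ mx l]; last first.
  right; apply: leq_trans prod_a_leq_D; apply: prod_e_leq_prod_a => i _.
  by apply: contraNT all_mx => nmi; apply/existsP; exists i.
left; have cl := nm_cyc l nml.
have [/existsP[j /andP[nejl nmj]] | one] := boolP [exists j, (j != l) && ~~ mx j].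
  wlog ltp : l j nejl nml nmj cl / p j < p l.
    move=> IH; have cj := nm_cyc j nmj.
    have [ltp | ltp | /p_inj eqjl] := ltngtP (p j) (p l); first exact: (IH l j).
      by apply: (IH j l) => //; rewrite eq_sym.
    by rewrite eqjl eqxx in nejl.
  exists l => //; apply: leq_trans prod_n_leq_D.
  (* The first product in [deg_omit l] is at most twice the product of totients, and [2 + (e l).-1]
     is [(e l).+1]. *)
  apply: (@leq_trans ((e l).+1 * \prod_(i | i != l) totient (e i))).
    have := totient_ratio (fun i _ => totient_e i) (lep_l l).
    have := e_gt0 l; rewrite /deg_omit; case: (e l) => // m _ /=.
    rewrite !mulSn; lia.
  rewrite (bigD1 j nejl) /= [X in _ <= X](bigD1 l) //= (bigD1 j nejl) /= !mulnA.
  apply: leq_mul; first exact: two_cyclic_roots (nm_cyc j nmj) nml nmj ltp.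
  by apply: leq_prod => i _; apply: totient_e_leq_n.
have mx_l i : i != l -> mx i.
  by move=> neil; apply: contraNT one => nmi; apply/existsP; exists i; rewrite neil.
exists l => //; rewrite (D_one_nonmax mx_l) /deg_omit.
have leA := prod_e_leq_prod_a mx_l.
have leF : \prod_(i | i != l) totient (e i) <= \prod_(i | i != l) totient (a i).
  by apply: leq_prod => i /mx_l/mxP[_]; apply: totient_e_leq_a.
have leFA : \prod_(i | i != l) totient (a i) <= \prod_(i | i != l) a i.
  by apply: leq_prod => i _; apply: totient_leq _.
have a1 := a_gt0 l.
have ale : a l <= e l.
  apply: leq_trans (cyc_nmxP cl nml); rewrite leq_pmull // prime_gt0 //.
have -> : n l - totient (a l) = e l - a l by have := cycP cl; lia.
apply: (leq_trans (leq_add leA (leq_mul (leqnn _) leF))).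
move: leFA; set A := \prod_(i | _) a i; set F := \prod_(i | _) totient (a i) => leFA.
(* The two sides differ by [(a l - 1) * (A - F)]. *)
have -> : (e l).-1 = (e l - a l) + (a l).-1 by lia.
rewrite -[X in _ <= X * _ + _](prednK a1) mulSn mulnDl.
have := leq_mul (leqnn (a l).-1) leFA; lia.
Qed.

End PrimaryArithmetic.

(** * Degree bounds and exact degrees in the nilpotent group *)

Lemma exists_min_order_max_cyclic (gT : finGroupType) (G : {group gT}) :
  exists y, min_order_max_cyclic G y.
Proof.
have [z0 maxz0 _] := max_cyclic_elt_exists (group1 G).
case: (@arg_minnP _ z0 (max_cyclic_elt G) (fun z => #[z]%g) maxz0) => y maxy miny.
exists y; split=> [|C maxC]; first by rewrite max_cyclic_eltE.
have /max_cyclicP[_ /cyclicP[z defC] _] := maxC.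
have eqC : C = <[z]>%G by apply: val_inj.
by rewrite defC; apply: miny; rewrite -max_cyclic_eltE -eqC.
Qed.

Section NilpotentDegree.

Local Open Scope group_scope.

Variables (gT : finGroupType) (G : {group gT}) (r : nat) (p : 'I_r -> nat).
Variable P : 'I_r -> {group gT}.
Hypothesis nilG : nilpotent G.
Hypothesis p_pr : forall i, prime (p i).
Hypothesis p_inj : injective p.
Hypothesis piG : forall q, q \in \pi(G) -> exists i, q = p i.
Hypothesis sylP : forall i, (p i).-Sylow(G) (P i).
Hypothesis cardG : #|G| = (\prod_(i < r) #|P i|)%N.
Hypothesis ntP : forall i, P i :!=: 1.
Hypothesis ncycZ : forall i, ~~ cyclic (P i) -> ~~ cyclic 'Z(P i).

Variable y : gT.
Hypothesis min_y : min_order_max_cyclic G y.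

Let e i := #[y.`_(p i)].

Let constt_in x i (Gx : x \in G) := constt_mem_sylow nilG sylP i Gx.
Let degE := power_deg_constts nilG piG sylP cardG.

Lemma min_y_constts : [/\ y \in G, forall i, max_cyclic_elt (P i) y.`_(p i)
  & forall i v, max_cyclic_elt (P i) v -> (e i <= #[v])%N].
Proof. exact: min_order_max_cyclic_constts min_y. Qed.

Let pP i : (p i).-group (P i) := pHall_pgroup (sylP i).

Lemma min_y_cyclic i : cyclic (P i) -> <[y.`_(p i)]> = P i.
Proof.
have [Gy maxy _] := min_y_constts.
case/cyclicP=> z defP; have /max_cyclic_eltP[Py maxyi] := maxy i.
apply/eqP; rewrite eqEsubset cycle_subG Py {1}defP cycle_subG maxyi //.
  by rewrite defP cycle_id.
by rewrite -defP.
Qed.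

(** The exponent is positive because a trivial constituent is not maximal in the nontrivial
    [P i]. *)
Lemma e_prime_power i : exists2 t, (0 < t)%N & e i = (p i ^ t)%N.
Proof.
have [Gy maxy _] := min_y_constts.
have [[|t] et] := p_natP (mem_p_elt (pP i) (constt_in i Gy)); last by exists t.+1.
have /max_cyclic_eltP[Py maxyi] := maxy i.
case/trivgPn: (ntP i) => z Pz nz1; case/negP: nz1.
have y1 : y.`_(p i) = 1 by apply/eqP; rewrite -order_eq1 et.
by have := maxyi z Pz; rewrite y1 group1 cycle1 inE; apply.
Qed.

Section Bounds.

Variable x : gT.
Hypothesis Gx : x \in G.

Let a i := #[x.`_(p i)].
Let n i := #|power_roots (P i) x.`_(p i)|.
Let mx i := max_cyclic_elt (P i) x.`_(p i).

Lemma a_prime_power i : exists s, a i = (p i ^ s)%N.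
Proof.
by have [s es] := p_natP (mem_p_elt (pP i) (constt_in i Gx)); exists s.
Qed.

Lemma roots_max i : mx i -> n i = totient (a i) /\ (e i <= a i)%N.
Proof.
move=> mi; split; first exact: roots_max_cyclic_elt.
by have [_ _] := min_y_constts; apply.
Qed.

Lemma roots_cyclic i : cyclic (P i) -> (n i + a i = totient (a i) + e i)%N.
Proof.
move=> c; rewrite [e i]/order (min_y_cyclic c).
exact: card_roots_cyclic (p_pr i) (pP i) c (constt_in i Gx).
Qed.

Lemma roots_cyclic_nonmax i : cyclic (P i) -> ~~ mx i -> (p i * a i <= e i)%N.
Proof.
move=> c nm; have cy := min_y_cyclic c; have Px := constt_in i Gx.
have [t _ et] := e_prime_power i; have [s as_] := a_prime_power i.
rewrite et as_ -expnS leq_exp2l ?prime_gt1 // ltnNge; apply: contra nm => le_ts.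
apply/max_cyclic_eltP; split=> // z Pz _.
have -> : <[x.`_(p i)]> = P i; last by [].
apply/eqP; rewrite eqEcard cycle_subG Px -cy -[#|_|]/(e i) -[#|_|]/(a i).
by rewrite et as_ leq_pexp2l ?prime_gt0.
Qed.

Lemma roots_noncyclic_nonmax i : ~~ cyclic (P i) -> ~~ mx i ->
  exists e', [/\ e i <= e', p i * a i <= e'
               & totient (a i) + p i * e' <= n i + p i * a i]%N.
Proof.
move=> nc nm; have [_ _ miny] := min_y_constts.
have [z maxz [le1 le2]] :=
  card_roots_noncyclic_center (p_pr i) (pP i) (ncycZ nc) (constt_in i Gx) nm.
by exists #[z]; split=> //; apply: miny.
Qed.

Lemma noncyclic_power_deg_bound : (forall i, ~~ cyclic (P i)) ->
    (forall l, \prod_(i < r | i != l) p i <=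
               2 * \prod_(i < r | i != l) (p i).-1)%N ->
  (\prod_i e i <= (power_deg G x).+1)%N.
Proof.
exact: (noncyclic_degree_bound p_pr p_inj e_prime_power a_prime_power roots_max
  roots_cyclic roots_cyclic_nonmax roots_noncyclic_nonmax (degE Gx)).
Qed.

Lemma cyclic_power_deg_bound : (1 < r)%N ->
    (\prod_(i < r) p i <= 2 * \prod_(i < r) (p i).-1)%N ->
  (exists2 k, cyclic (P k) & (deg_omit e k <= (power_deg G x).+1)%N) \/
  (\prod_i e i <= (power_deg G x).+1)%N.
Proof.
rewrite -{1}(card_ord r).
exact: (cyclic_degree_bound p_pr p_inj e_prime_power a_prime_power roots_max
  roots_cyclic roots_cyclic_nonmax roots_noncyclic_nonmax (degE Gx)).
Qed.

End Bounds.

(** All constituents of [y] are maximal, so the product of root numbers cancels the product of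
    totients. *)
Lemma power_deg_min_y : (power_deg G y).+1 = (\prod_i e i)%N.
Proof.
have [Gy maxy _] := min_y_constts; have := degE Gy.
rewrite [X in (_ = _ + X)%N -> _](eq_bigr (fun i => totient (e i))) => [/addIn-> // | i _].
by rewrite roots_max_cyclic_elt.
Qed.

(** The exponent kills the [k]-th constituent, whose roots then fill [P k], and changes the others
    only to other generators of the same subgroups. *)
Lemma power_deg_omit k : cyclic (P k) ->
  (power_deg G (y ^+ #|P k|)).+1 = deg_omit e k.
Proof.
move=> ck; have [Gy maxy _] := min_y_constts; have := degE (groupX #|P k| Gy).
have ek : #|P k| = e k by rewrite /e /order min_y_cyclic.
have genE i : i != k -> <[(y ^+ #|P k|).`_(p i)]> = <[y.`_(p i)]>.
  move=> neik; apply/eqP; rewrite consttX eq_sym.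
  have [t _ et] := e_prime_power i; have [s _ es] := e_prime_power k.
  rewrite -[_ == _]/(generator _ _) generator_coprime -[#[_]]/(e i) et ek es.
  rewrite coprimeXl // coprimeXr // prime_coprime // dvdn_prime2 //.
  by apply: contraNneq neik => /p_inj->.
have ordE i : i != k -> #[(y ^+ #|P k|).`_(p i)] = e i.
  by move=> neik; rewrite /order genE.
have yk1 : (y ^+ #|P k|).`_(p k) = 1.
  by rewrite consttX ek expg_order.
rewrite (bigD1 k) //= [(\prod_i #[_])%N](bigD1 k) //= [(\prod_i #|_|)%N](bigD1 k) //=.
rewrite yk1 order1 (_ : totient 1 = 1)%N // !mul1n.
have -> : power_roots (P k) 1 = P k by apply/setP=> z; rewrite inE group1 andbT.
rewrite (eq_bigr (fun i => totient (e i))); last by move=> i neik; rewrite ordE.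
rewrite [X in (_ = X + _)%N -> _](eq_bigr e) //.
rewrite [X in (_ = _ + _ * X)%N -> _](eq_bigr (fun i => totient (e i))); last first.
  move=> i neik; rewrite -(roots_max_cyclic_elt (maxy i)); apply: eq_card => z.
  by rewrite !inE -!cycle_subG genE.
have -> : #|P k| = (e k).-1.+1 by rewrite prednK ?order_gt0.
by rewrite mulSn addnCA [X in _ = X -> _]addnC => /addIn.
Qed.

End NilpotentDegree.

(** * The minimum degree *)

Theorem theorem1p2 (gT : finGroupType) (G : {group gT})
    (r : nat) (p alpha : 'I_r -> nat)
    (P : 'I_r -> {group gT}) (J : {set 'I_r})
    (hr : 2 <= r)
    (hncyc : ~~ cyclic G)
    (hnil : nilpotent G)
    (hp : forall i, prime (p i))
    (hlt : forall i j : 'I_r, i < j -> p i < p j)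
    (halpha : forall i, 1 <= alpha i)
    (hcard : #|G| = \prod_(i < r) p i ^ alpha i)
    (hP : forall i, ((p i).-Sylow(G) (P i))%g)
    (hJ : J = [set i | ~~ cyclic (P i)])
    (hZ : forall j, j \in J -> ~~ cyclic 'Z(P j)%g) :
  (J <> [set: 'I_r] ->
   2 * totient (\prod_(i < r) p i) >= \prod_(i < r) p i ->
   exists k : 'I_r, k \notin J /\
     forall y : gT, min_order_max_cyclic G y ->
       power_min_deg G = power_deg G (y ^+ (p k ^ alpha k)%N)%g)
  /\
  (J = [set: 'I_r] ->
   (forall l : 'I_r,
      2 * totient (\prod_(i < r | i != l) p i) >= \prod_(i < r | i != l) p i) ->
   forall y : gT, min_order_max_cyclic G y ->
     power_min_deg G = power_deg G y).
Proof.
have p_inj : injective p.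
  move=> i j eq_p; apply/val_inj; case: (ltngtP i j) => // /hlt; rewrite eq_p ltnn //.
have piG q : q \in \pi(G) -> exists i, q = p i.
  rewrite mem_primes => /and3P[q_pr _ q_dvG].
  have: q %| \prod_(i < r) p i ^ alpha i by rewrite -hcard.
  rewrite Euclid_dvd_prod // big_has_cond => /hasP[i _ /andP[_]].
  by rewrite Euclid_dvdX // => /andP[+ _]; rewrite dvdn_prime2 // => /eqP->; exists i.
have cardP i : #|P i| = p i ^ alpha i.
  have cop : coprime (p i) (\prod_(j < r | j != i) p j ^ alpha j).
    apply: (big_ind (coprime (p i))) => [|m1 m2|j neji].
    - exact: coprimen1.
    - by rewrite coprimeMr => -> ->.
    rewrite coprimeXr // prime_coprime // dvdn_prime2 //.
    by apply: contraNneq neji => /p_inj->.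
  rewrite (card_Hall (hP i)) p_part hcard (bigD1 i) //= lognM ?expn_gt0 ?(prime_gt0 (hp i)) //.
    by rewrite pfactorK // logn_coprime ?addn0.
  by rewrite prodn_cond_gt0 // => j _; rewrite expn_gt0 prime_gt0.
have cardG : #|G| = \prod_(i < r) #|P i| by rewrite hcard; apply: eq_bigr => i _.
have ntP i : (P i :!=: 1)%g.
  by rewrite -cardG_gt1 cardP -(expn0 (p i)) ltn_exp2l ?prime_gt1.
have ncycZ i : ~~ cyclic (P i) -> ~~ cyclic 'Z(P i)%g.
  by move=> nc; apply: hZ; rewrite hJ inE.
have [[v Gv ->] minv] := power_min_degP G.
have minE u : u \in G ->
    (power_deg G u).+1 <= (power_deg G v).+1 -> power_deg G v = power_deg G u.
  move=> Gu leuv; apply/eqP; rewrite eqn_leq -[_ u <= _]ltnS leuv andbT.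
  exact: minv.
have min_in y : min_order_max_cyclic G y -> y \in G.
  by case; rewrite max_cyclic_eltE => /andP[].
split=> [nJT | JT] ratio.
  have [y0 min_y0] := exists_min_order_max_cyclic G.
  pose e0 i := #[y0.`_(p i)]%g.
  have [k0 ck0] : exists k, cyclic (P k).
    apply/existsP; apply: contra_notT nJT; rewrite negb_exists => /forallP nc.
    by apply/setP=> i; rewrite hJ !inE nc.
  (* The index [k] must serve every [y], so it is fixed beforehand through one [y0], minimising
     [deg_omit] over the cyclic Sylow subgroups. *)
  have [k ck mink] := @arg_minnP _ k0 (fun k => cyclic (P k)) (deg_omit e0) ck0.
  have le_k : deg_omit e0 k <= (power_deg G v).+1.
    move: ratio; rewrite totient_prod_primes // => ratio.
    have [[k' ck' le_k'] | le_prod] := cyclic_power_deg_bound hnil hp p_inj piG hP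
      cardG ntP ncycZ min_y0 Gv hr ratio.
      exact: leq_trans (mink k' ck') le_k'.
    apply: leq_trans le_prod; apply: (deg_omit_leq hp).
    exact: (e_prime_power hnil piG hP cardG ntP min_y0).
  exists k; split=> [|y min_y]; first by rewrite hJ inE ck.
  (* Minimality in both directions gives [y] and [y0] the same constituent orders, hence the same
     [deg_omit]. *)
  have eqe i : #[y.`_(p i)]%g = e0 i.
    have [_ maxy miny] := min_order_max_cyclic_constts hnil piG hP cardG min_y.
    have [_ maxy0 miny0] := min_order_max_cyclic_constts hnil piG hP cardG min_y0.
    by apply/eqP; rewrite eqn_leq miny ?miny0.
  apply: minE; first by rewrite groupX ?min_in.
  rewrite -cardP (power_deg_omit hnil hp p_inj piG hP cardG ntP min_y ck).
  apply: leq_trans le_k; rewrite /deg_omit eqe.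
  by rewrite leq_add ?leq_mul // leq_prod // => i _; rewrite eqe.
move=> y min_y; apply: minE; first exact: min_in.
rewrite (power_deg_min_y hnil piG hP cardG min_y).
apply: (noncyclic_power_deg_bound hnil hp p_inj piG hP cardG ntP ncycZ min_y Gv).
  by move=> i; have := in_setT i; rewrite -JT hJ inE.
by move=> l; have := ratio l; rewrite totient_prod_primes.
Qed.
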